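(* Let $X\neq\{0\}$ be a Banach space over $\mathbb{K}$ and let $N\ge1$ be an integer. (a) For every orthonormal basis $\mathcal{B}=\{u_1,\dots,u_N\}$ of $\mathbb{K}^N$, the associated graph Fourier transform $\mathcal{F}:L^2(V,X)\to L^2(V,X)$ is a topological isomorphism, and $1\le\|\mathcal{F}\|_{2\to2}\le N^{1/2}$. (b) If $N=1$, then $\|\hat f\|_2=\|f\|_2$ for all $u\in\mathbb{K}$ with $|u|=1$ (the single basis vector) and all $f\in X$. So $\mathcal{F}:L^2(V,X)\to L^2(V,X)$ is an isometric isomorphism, and $\|\mathcal{F}\|_{2\to2}=1$. (c) If $N\ge2$, then $\|\hat f\|_2=\|f\|_2$ holds for all $U\in\mathrm{U}(N,\mathbb{K})$ and all $f\in X^N$ if and only if $X$ is a Hilbert space. (d) If $N\ge2$, then $\|\mathcal{F}\|_{2\to2}=1$ holds for all $U\in\mathrm{U}(N,\mathbb{K})$ if and only if $X$ is a Hilbert space.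
   Context: $\mathbb{K}$ is $\mathbb{R}$ or $\mathbb{C}$, $V=\{1,\dots,N\}$. An $X$-valued signal is a function $f:V\to X$, identified with $(f(1),\dots,f(N))\in X^N$. $L^2(V,X)$ denotes $X^N$ with norm $\|f\|_2=\left(\sum_{n=1}^N\|f(n)\|^2\right)^{1/2}$. An orthonormal basis $\{u_1,\dots,u_N\}$ of $\mathbb{K}^N$ corresponds to the unitary matrix $U$ with columns $u_1,\dots,u_N$ (entry $u_k(n)$ in row $n$, column $k$). $\mathrm{U}(N,\mathbb{K})$ is the group of $N\times N$ matrices $U$ over $\mathbb{K}$ with $UU^*=U^*U=I$ (the unitary group if $\mathbb{K}=\mathbb{C}$, the orthogonal group if $\mathbb{K}=\mathbb{R}$). The graph Fourier transform associated with $U$ is $\mathcal{F}:X^N\to X^N$, $\mathcal{F}f=\hat f$, $\hat f(k)=\sum_{n=1}^N\overline{u_k(n)}f(n)$, i.e. $\hat f=U^*f$; in (c) and (d), $\hat f$ and $\mathcal{F}$ are those associated with $U$. ''$X$ is a Hilbert space'' means that the norm of $X$ is induced by an inner product. A topological isomorphism is a linear bijection that is continuous with continuous inverse; $\|\cdot\|_{2\to2}$ is the operator norm on $L^2(V,X)$. *)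

(* Defs.v *)
From HB Require Import structures.
From mathcomp Require Import all_boot all_order all_algebra.
From mathcomp Require Import sesquilinear complex.
From mathcomp Require Import all_classical all_reals all_analysis.
From mathcomp Require Import ring.
Import Order.TTheory GRing.Theory Num.Theory.

Set Implicit Arguments.
Unset Strict Implicit.
Unset Printing Implicit Defensive.

Local Open Scope ring_scope.
Local Open Scope complex_scope.
Local Open Scope classical_set_scope.

Variant scalar_kind := RealScalars | ComplexScalars.

Definition scalar_field (R : realType) (k : scalar_kind) : numFieldType :=
  match k with
  | RealScalars => R
  | ComplexScalars => R[i]
  end.

Section ScalarOps.
Variable R : realType.

Definition conjK (k : scalar_kind) : scalar_field R k -> scalar_field R k :=
  match k with
  | RealScalars => fun x => x
  | ComplexScalars => fun z => conjc z
  end.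

Definition ReK (k : scalar_kind) : scalar_field R k -> R :=
  match k with
  | RealScalars => fun x => x
  | ComplexScalars => fun z => complex.Re z
  end.

Definition ofR (k : scalar_kind) : R -> scalar_field R k :=
  match k with
  | RealScalars => fun x => x
  | ComplexScalars => fun x => x%:C
  end.

Variable k : scalar_kind.

Lemma ReK_id (z : scalar_field R k) : 0 <= z -> ofR k (ReK z) = z.
Proof. by case: k z => //= -[a b]; rewrite lecE /= => /andP[/eqP-> _]. Qed.

Lemma ofRK (x : R) : ReK (ofR k x) = x.
Proof. by case: k. Qed.

Lemma ler_ofR (x y : R) : (ofR k x <= ofR k y) = (x <= y).
Proof. by case: k => //=; rewrite lecR. Qed.

Lemma ofRD (x y : R) : ofR k (x + y) = ofR k x + ofR k y.
Proof. by case: k => //=; rewrite rmorphD. Qed.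

Lemma ofRM (x y : R) : ofR k (x * y) = ofR k x * ofR k y.
Proof. by case: k => //=; rewrite rmorphM. Qed.

Lemma ofR0 : ofR k 0 = 0.
Proof. by case: k. Qed.

Lemma ler_ReK (z w : scalar_field R k) : 0 <= z -> 0 <= w -> (ReK z <= ReK w) = (z <= w).
Proof. by move=> z0 w0; rewrite -ler_ofR !ReK_id. Qed.

Lemma ReK_ge0 (z : scalar_field R k) : 0 <= z -> 0 <= ReK z.
Proof. by move=> z0; rewrite -ler_ofR ReK_id // ofR0. Qed.

Lemma ReKD (z w : scalar_field R k) : ReK (z + w) = ReK z + ReK w.
Proof. by case: k z w => //= -[a b] [c d]. Qed.

Lemma ReKM (z w : scalar_field R k) :
  0 <= z -> 0 <= w -> ReK (z * w) = ReK z * ReK w.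
Proof. by move=> z0 w0; rewrite -{1}(ReK_id z0) -{1}(ReK_id w0) -ofRM ofRK. Qed.

End ScalarOps.
Arguments ofR {R} k.

(* A normedModType over [scalar_field R k] has a [scalar_field R k]-valued norm; it is
   nonnegative, hence real, and [rnorm] is the same number read in [R]. *)
Definition rnorm (R : realType) (k : scalar_kind)
  (X : normedModType (scalar_field R k)) (x : X) : R := ReK `|x|.

(* X^N under its own name, so that the 2-norm below, and the topology it
   induces, are the canonical ones on this type. *)
Definition L2 (R : realType) (k : scalar_kind) (X : normedModType (scalar_field R k))
  (N : nat) : Type := {ffun 'I_N -> X}.

HB.instance Definition _ (R : realType) (k : scalar_kind)
  (X : normedModType (scalar_field R k)) (N : nat) :=
  GRing.Lmodule.copy (L2 X N) {ffun 'I_N -> X}.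

Lemma cauchy_schwarz_sum (R : rcfType) (N : nat) (a b : 'I_N -> R) :
  (\sum_i a i * b i) ^+ 2 <= (\sum_i a i ^+ 2) * (\sum_i b i ^+ 2).
Proof.
set A := \sum_i a i ^+ 2; set B := \sum_i b i ^+ 2; set C := \sum_i a i * b i.
have B0 : 0 <= B by apply: sumr_ge0 => i _; exact: sqr_ge0.
have [B00|Bn0] := eqVneq B 0.
  have b0 i : b i = 0.
    apply/eqP; rewrite -sqrf_eq0; apply/eqP.
    by apply: (psumr_eq0P _ B00) => // j _; exact: sqr_ge0.
  rewrite /C big1 ?expr0n ?B00 ?mulr0 // => i _; by rewrite b0 mulr0.
have Bp : 0 < B by rewrite lt_def Bn0.
have : 0 <= \sum_i (B * a i - C * b i) ^+ 2.
  by apply: sumr_ge0 => i _; exact: sqr_ge0.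
have -> : \sum_i (B * a i - C * b i) ^+ 2 = B * (A * B - C ^+ 2).
  have E p q : \sum_i (p * a i - q * b i) ^+ 2 =
      p ^+ 2 * A - (p * q *+ 2) * C + q ^+ 2 * B.
    rewrite /A /B /C !mulr_sumr -sumrB -big_split /=.
    by apply: eq_bigr => i _; ring.
  by rewrite E; ring.
by rewrite pmulr_rge0 // subr_ge0.
Qed.

Lemma minkowski_sum (R : rcfType) (N : nat) (a b : 'I_N -> R) :
  Num.sqrt (\sum_i (a i + b i) ^+ 2) <=
  Num.sqrt (\sum_i a i ^+ 2) + Num.sqrt (\sum_i b i ^+ 2).
Proof.
have sq0 (c : 'I_N -> R) : 0 <= \sum_i c i ^+ 2.
  by apply: sumr_ge0 => i _; exact: sqr_ge0.
set A := \sum_i a i ^+ 2; set B := \sum_i b i ^+ 2.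
have ABs : 0 <= Num.sqrt A + Num.sqrt B by rewrite addr_ge0 ?sqrtr_ge0.
rewrite -[leRHS](ger0_norm ABs) -sqrtr_sqr ler_wsqrtr // sqrrD !sqr_sqrtr ?sq0 //.
have -> : \sum_i (a i + b i) ^+ 2 = A + (\sum_i a i * b i) *+ 2 + B.
  rewrite /A /B -sumrMnl -!big_split /=.
  by apply: eq_bigr => i _; rewrite sqrrD.
rewrite lerD2r lerD2l lerMn2r /=; apply: le_trans (ler_norm _) _.
rewrite -sqrtrM; last exact: sq0.
by rewrite -sqrtr_sqr ler_wsqrtr // cauchy_schwarz_sum.
Qed.

Section L2Norm.
Variables (R : realType) (k : scalar_kind) (X : normedModType (scalar_field R k)).
Variable N : nat.

Definition L2norm (f : L2 X N) : scalar_field R k :=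
  ofR k (Num.sqrt (\sum_(n < N) rnorm (f n) ^+ 2)).

Lemma L2norm_triangle (f g : L2 X N) : L2norm (f + g) <= L2norm f + L2norm g.
Proof.
rewrite -ofRD ler_ofR (le_trans _ (minkowski_sum _ _)) // ler_wsqrtr //.
apply: ler_sum => n _; rewrite ffunE lerXn2r ?nnegrE ?addr_ge0 ?ReK_ge0 //.
by rewrite -ReKD ler_ReK ?addr_ge0 // ler_normD.
Qed.

Lemma L2norm_scale (l : scalar_field R k) (f : L2 X N) :
  L2norm (l *: f) = `|l| * L2norm f.
Proof.
rewrite -(ReK_id (normr_ge0 l)) -ofRM; congr (ofR k _).
rewrite -[ReK `|l|]ger0_norm ?ReK_ge0 // -sqrtr_sqr -sqrtrM ?sqr_ge0 //.
congr (Num.sqrt _); rewrite mulr_sumr; apply: eq_bigr => n _.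
by rewrite ffunE /rnorm normrZ ReKM // exprMn.
Qed.

Lemma L2norm_eq0 (f : L2 X N) : L2norm f = 0 -> f = 0.
Proof.
move=> /(congr1 (@ReK R k)); rewrite ofRK -{1}(ofR0 R k) ofRK => /eqP.
rewrite sqrtr_eq0 => s0; apply/ffunP => n; rewrite ffunE.
have sq0 (i : 'I_N) : true -> 0 <= rnorm (f i) ^+ 2 by move=> _; exact: sqr_ge0.
have /eqP : \sum_(i < N) rnorm (f i) ^+ 2 = 0.
  by apply: le_anti; rewrite s0 sumr_ge0.
rewrite psumr_eq0 // => /allP /(_ n (mem_index_enum _)) /=.
rewrite sqrf_eq0 => /eqP /(congr1 (ofR k)); rewrite ReK_id // ofR0.
by move/eqP; rewrite normr_eq0 => /eqP.
Qed.

HB.instance Definition _ := Lmodule_isNormed.Build (scalar_field R k) (L2 X N)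
  L2norm_triangle L2norm_scale L2norm_eq0.

Lemma L2normE (f : L2 X N) :
  rnorm f = Num.sqrt (\sum_(n < N) rnorm (f n) ^+ 2).
Proof. exact: ofRK. Qed.

Definition dotK (u v : 'cV[scalar_field R k]_N) : scalar_field R k :=
  \sum_(n < N) u n 0 * conjK (v n 0).

Definition orthonormal_basis (u : 'I_N -> 'cV[scalar_field R k]_N) : Prop :=
  basis_of fullv [seq u i | i : 'I_N] /\
  forall i j, dotK (u i) (u j) = (i == j)%:R.

Definition adjoint (U : 'M[scalar_field R k]_N) : 'M[scalar_field R k]_N :=
  (map_mx (@conjK R k) U)^T.

Definition unitary (U : 'M[scalar_field R k]_N) : Prop :=
  U *m adjoint U = 1%:M /\ adjoint U *m U = 1%:M.

Definition gft (u : 'I_N -> 'cV[scalar_field R k]_N) (f : L2 X N) : L2 X N :=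
  [ffun i => \sum_(n < N) conjK (u i n 0) *: f n].

Definition gft_mx (U : 'M[scalar_field R k]_N) : L2 X N -> L2 X N :=
  gft (fun i => col i U).

End L2Norm.

Section NormedMaps.
Variables (R : realType) (k : scalar_kind).
Variables (E F : normedModType (scalar_field R k)).

Definition topological_isomorphism (T : E -> F) : Prop :=
  [/\ linear T, continuous T &
      exists S : F -> E, [/\ cancel T S, cancel S T & continuous S]].

Definition isometric_isomorphism (T : E -> F) : Prop :=
  [/\ linear T, bijective T & forall x, `|T x| = `|x| :> scalar_field R k].

(* Valued in the extended reals: an unbounded [T] has norm [+oo]. *)
Definition op_norm (T : E -> F) : \bar R :=
  ereal_sup [set (rnorm (T x))%:E | x in [set x : E | rnorm x <= 1]].

End NormedMaps.

(* Completeness is already part of the type of [X]. *)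
Definition is_hilbert (R : realType) (k : scalar_kind)
  (X : completeNormedModType (scalar_field R k)) : Prop :=
  exists ip : {dot X for @conjK R k}, forall x : X, `|x| ^+ 2 = ip x x.

(* Main.v *)
Require Import Defs.
From HB Require Import structures.
From mathcomp Require Import all_boot all_order all_algebra.
From mathcomp Require Import sesquilinear complex.
From mathcomp Require Import all_classical all_reals all_analysis.
From mathcomp Require Import ring lra.
Import Order.TTheory GRing.Theory Num.Theory.
Local Open Scope ring_scope.

(** Everything rests on reading a graph Fourier transform as the action of a
    unitary matrix on X^N. Composing transforms multiplies the matrices
    ([gft_mxM]), so the transform of [U] is invertible, with the transform of
    [U^*] as inverse. Each coordinate of the transform of f is a combination of
    the f(n) whose coefficients have l^2 norm 1, so by Cauchy-Schwarz its norm is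
    at most that of f ([rnorm_gft_mx_coord]); adding the N coordinates gives the bound
    sqrt N. A unit vector placed at one vertex is sent to a vector of the same
    norm, whence the lower bound 1.

    If X is a Hilbert space, expanding the inner products shows that unitary
    matrices act by isometries ([dot_gft_isometric]). Conversely, suppose that
    they all do and that N >= 2. The reflection with rows (a, b) and (b, -a),
    acting on two coordinates, gives after rescaling, for all real a and b,
      |ax + by|^2 + |bx - ay|^2 = (a^2 + b^2) (|x|^2 + |y|^2).
    Put B(x, y) = (|x + y|^2 - |x - y|^2) / 4. The case a = b = 1 is the
    parallelogram law, which makes B biadditive. The case b = 1 makes
    multiplication by a real a self-adjoint for B; as B(ax, x) = a|x|^2 by
    homogeneity of the norm, polarization gives B(ax, y) = a B(x, y). Thus B is
    bilinear over the reals, with no passage through rational scalars and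
    continuity as in the usual proof of the Jordan-von Neumann theorem. Over the
    complex numbers the inner product is B(x, y) + i B(x, iy).

    The criterion by operator norms reduces to the one by isometries: if the
    transforms of [U] and of [U^*] both have norm 1, they are mutually inverse
    contractions, hence isometries ([contractive_gft_isometric]). *)

(** * Scalars and norms *)

Section Scalars.
Context (R : realType) (k : scalar_kind).
Local Notation K := (scalar_field R k).

Lemma conjK_zmod_morphism : zmod_morphism (@conjK R k).
Proof. by case: k => //= z w; rewrite rmorphB. Qed.

Lemma conjK_monoid_morphism : monoid_morphism (@conjK R k).
Proof. by case: k => //=; split=> [|z w]; rewrite ?rmorph1 ?rmorphM. Qed.

HB.instance Definition _ :=
  GRing.isZmodMorphism.Build K K (@conjK R k) conjK_zmod_morphism.
HB.instance Definition _ :=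
  GRing.isMonoidMorphism.Build K K (@conjK R k) conjK_monoid_morphism.

Lemma conjKK : involutive (@conjK R k).
Proof. by case: k => //= z; rewrite conjcK. Qed.

Lemma conjK_ofR (a : R) : conjK (ofR k a) = ofR k a.
Proof. by case: k => //=; rewrite oppr0. Qed.

Lemma ofRB (a b : R) : ofR k (a - b) = ofR k a - ofR k b.
Proof. by case: k => //=; rewrite rmorphB. Qed.

Lemma ofR1 : ofR k (1 : R) = 1.
Proof. by case: k. Qed.

Lemma mulKconj (z : K) : z * conjK z = `|z| ^+ 2.
Proof.
case: k z => /= z; last by rewrite sqr_normc.
by rewrite -normrX ger0_norm ?sqr_ge0 ?expr2.
Qed.

Lemma norm_conjK (z : K) : `|conjK z| = `|z|.
Proof.
by apply/eqP; rewrite -(@eqrXn2 _ 2)// -!mulKconj conjKK mulrC.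
Qed.

Lemma ReK_norm_ofR (a : R) : ReK `|ofR k a| = `|a|.
Proof.
by case: k => //=; rewrite expr0n addr0 sqrtr_sqr.
Qed.

Lemma ReK_sum (I : finType) (F : I -> K) : ReK (\sum_i F i) = \sum_i ReK (F i).
Proof.
by apply: (big_morph _ (@ReKD R k)); rewrite -{1}(ofR0 R k) ofRK.
Qed.

Lemma ofR_sum (I : finType) (F : I -> R) :
  ofR k (\sum_i F i) = \sum_i ofR k (F i).
Proof. exact: (big_morph _ (@ofRD R k) (ofR0 R k)). Qed.

Context (X : normedModType K).

Lemma ofR_rnorm (x : X) : ofR k (rnorm x) = `|x|.
Proof. exact: ReK_id. Qed.

Lemma rnorm_ge0 (x : X) : 0 <= rnorm x.
Proof. exact: ReK_ge0. Qed.

Lemma rnorm0 : rnorm (0 : X) = 0.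
Proof. by rewrite /rnorm normr0 -(ofR0 R k) ofRK. Qed.

Lemma rnormZ (a : K) (x : X) : rnorm (a *: x) = ReK `|a| * rnorm x.
Proof. by rewrite /rnorm normrZ ReKM. Qed.

Lemma rnormZr (a : R) (x : X) : rnorm (ofR k a *: x) = `|a| * rnorm x.
Proof. by rewrite rnormZ ReK_norm_ofR. Qed.

Lemma ler_rnormD (x y : X) : rnorm (x + y) <= rnorm x + rnorm y.
Proof. by rewrite -ReKD ler_ReK ?addr_ge0 ?ler_normD. Qed.

Lemma ler_rnorm_sum (I : finType) (F : I -> X) :
  rnorm (\sum_i F i) <= \sum_i rnorm (F i).
Proof.
elim/big_rec2: _ => [|i y x _ le_xy]; first by rewrite rnorm0.
by apply: le_trans (ler_rnormD _ _) _; rewrite lerD2l.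
Qed.

Lemma rnorm_eq0 (x : X) : (rnorm x == 0) = (x == 0).
Proof.
apply/eqP/eqP => [x0|->]; last exact: rnorm0.
by apply/eqP; rewrite -normr_eq0 -ofR_rnorm x0 ofR0.
Qed.

Lemma exists_rnorm1 : (exists x : X, x != 0) -> exists x : X, rnorm x = 1.
Proof.
move=> [x x0]; exists (ofR k (rnorm x)^-1 *: x).
rewrite rnormZr ger0_norm ?invr_ge0 ?rnorm_ge0//.
by rewrite mulVf// rnorm_eq0.
Qed.

End Scalars.

(** * Operator norms *)

Section OpNorm.
Context (R : realType) (k : scalar_kind).
Local Notation K := (scalar_field R k).
Context (E F : normedModType K).

Lemma op_norm_le (T : E -> F) (c : R) : 0 <= c ->
  (forall x, rnorm (T x) <= c * rnorm x) -> (op_norm T <= c%:E)%E.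
Proof.
move=> c0 Tc; apply: ge_ereal_sup => _ [x /= x1 <-].
by rewrite lee_fin (le_trans (Tc x))// ler_piMr.
Qed.

Lemma le_op_norm (T : E -> F) (x : E) :
  rnorm x <= 1 -> ((rnorm (T x))%:E <= op_norm T)%E.
Proof. by move=> x1; apply: ereal_sup_ubound; exists x. Qed.

Lemma op_norm_isometry (T : E -> F) : (exists x : E, x != 0) ->
  (forall x, rnorm (T x) = rnorm x) -> op_norm T = 1%E.
Proof.
move=> /exists_rnorm1[x x1] TE; apply/eqP; rewrite eq_le; apply/andP; split.
  by apply: op_norm_le => // y; rewrite mul1r TE.
by rewrite -[X in (X%:E <= _)%E]x1 -(TE x) le_op_norm ?x1.
Qed.

(** The operator norm only controls the unit ball; linearity brings every other
    vector back to the unit sphere. *)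
Lemma op_norm1_contraction (T : E -> F) : linear T -> op_norm T = 1%E ->
  forall x, rnorm (T x) <= rnorm x.
Proof.
move=> linT T1 x; have TZ : scalable T := scalable_linear linT.
have [->|x0] := eqVneq x 0.
  by rewrite -(scale0r (0 : E)) TZ !scale0r !rnorm0.
have nx0 : 0 < rnorm x by rewrite lt_def rnorm_eq0 x0 rnorm_ge0.
have := @le_op_norm T (ofR k (rnorm x)^-1 *: x).
rewrite TZ !rnormZr ger0_norm ?invr_ge0 ?rnorm_ge0// mulVf ?gt_eqF//.
by rewrite T1 lee_fin ler_pdivrMl// mulr1; apply.
Qed.

(** Bounds are real here, whereas the norms that define the topology take values
    in the scalar field, so the bound is transported to that field. *)
Lemma bounded_linear_map_continuous (T : E -> F) (c : R) : linear T ->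
  (forall x, rnorm (T x) <= c * rnorm x) -> continuous T.
Proof.
move=> linT Tc.
pose T' : {linear E -> F} :=
  HB.pack T (GRing.isLinear.Build K E F *:%R T linT).
apply: (@bounded_linear_continuous K E F T'); apply/linear_boundedP.
near=> r => x; rewrite -[X in X <= _]ofR_rnorm -[X in _ <= _ * X]ofR_rnorm.
apply: (@le_trans _ _ (ofR k c * ofR k (rnorm x))).
  by rewrite -ofRM ler_ofR Tc.
rewrite ler_wpM2r -?(ofR0 R k) ?ler_ofR ?rnorm_ge0//.
near: r; apply: nbhs_pinfty_ge.
by rewrite realE -(ofR0 R k) !ler_ofR -realE num_real.
Unshelve. all: by end_near. Qed.

End OpNorm.

(** * Graph Fourier transforms and unitary matrices *)

Section Fourier.
Context (R : realType) (k : scalar_kind).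
Local Notation K := (scalar_field R k).

Lemma adjointE N (U : 'M[K]_N) i j : adjoint U i j = conjK (U j i).
Proof. by rewrite !mxE. Qed.

Lemma adjointK N (U : 'M[K]_N) : adjoint (adjoint U) = U.
Proof. by apply/matrixP => i j; rewrite !adjointE conjKK. Qed.

Lemma unitary_adjoint N (U : 'M[K]_N) : unitary U -> unitary (adjoint U).
Proof. by rewrite /unitary adjointK => -[]. Qed.

(** Orthonormality says [U^* U = 1], and for square matrices a left inverse is a
    right inverse. *)
Lemma orthonormal_unitary N (u : 'I_N -> 'cV[K]_N) :
  (forall i j, dotK (u i) (u j) = (i == j)%:R) ->
  unitary (\matrix_(n, i) u i n 0).
Proof.
move=> u_on; set U := \matrix_(n, i) _.
suff UU : adjoint U *m U = 1%:M by split=> //; apply: mulmx1C.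
apply/matrixP => i j; rewrite !mxE eq_sym -u_on; apply: eq_bigr => n _.
by rewrite adjointE !mxE mulrC.
Qed.

Lemma unitary_col_norm N (U : 'M[K]_N) i : unitary U ->
  \sum_n ReK `|U n i| ^+ 2 = 1.
Proof.
move=> [_ /matrixP/(_ i i)]; rewrite !mxE eqxx => UU.
have -> : 1 = ReK (true%:R : K) by rewrite -[true%:R]ofR1 ofRK.
rewrite -UU ReK_sum; apply: eq_bigr => n _.
by rewrite adjointE mulrC mulKconj !expr2 ReKM.
Qed.

Context (X : normedModType K).

Lemma gft_mxE N (U : 'M[K]_N) (f : L2 X N) i :
  gft_mx U f i = \sum_n conjK (U n i) *: f n.
Proof. by rewrite ffunE; apply: eq_bigr => n _; rewrite mxE. Qed.

(** A transform depends on its basis only through the matrix of the columns, so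
    that the statements about bases and about matrices have a common form. *)
Lemma gft_gft_mx N (u : 'I_N -> 'cV[K]_N) :
  gft u = gft_mx (\matrix_(n, i) u i n 0) :> (L2 X N -> L2 X N).
Proof.
apply/funext => f; apply/ffunP => i; rewrite gft_mxE ffunE.
by apply: eq_bigr => n _; rewrite mxE.
Qed.

Lemma gft_mx_linear N (U : 'M[K]_N) : linear (gft_mx U : L2 X N -> L2 X N).
Proof.
move=> a f g; apply/ffunP => i; rewrite !(ffunE, gft_mxE).
rewrite scaler_sumr -big_split.
apply: eq_bigr => n _ /=.
by rewrite !ffunE scalerDr !scalerA [a * _]mulrC.
Qed.

Lemma gft_mx1 N (f : L2 X N) : gft_mx 1%:M f = f.
Proof.
apply/ffunP => i; rewrite gft_mxE (bigD1 i)//= big1 ?addr0 => [|n ni].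
  by rewrite mxE eqxx rmorph1 scale1r.
by rewrite mxE (negPf ni) rmorph0 scale0r.
Qed.

(** The order is reversed because the transform of [U] acts as [U^*]. *)
Lemma gft_mxM N (U V : 'M[K]_N) (f : L2 X N) :
  gft_mx U (gft_mx V f) = gft_mx (V *m U) f.
Proof.
apply/ffunP => i; rewrite !gft_mxE.
under eq_bigr => n _ do rewrite gft_mxE scaler_sumr.
rewrite exchange_big; apply: eq_bigr => n _ /=.
rewrite mxE rmorph_sum scaler_suml; apply: eq_bigr => m _ /=.
by rewrite rmorphM scalerA mulrC.
Qed.

Lemma gft_mxK N (U : 'M[K]_N) : unitary U ->
  cancel (gft_mx U : L2 X N -> L2 X N) (gft_mx (adjoint U)).
Proof. by move=> [UU _] f; rewrite gft_mxM UU gft_mx1. Qed.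

Lemma gft_mxVK N (U : 'M[K]_N) : unitary U ->
  cancel (gft_mx (adjoint U) : L2 X N -> L2 X N) (gft_mx U).
Proof. by move=> [_ UU] f; rewrite gft_mxM UU gft_mx1. Qed.

Lemma rnorm_L2_sqr N (f : L2 X N) : rnorm f ^+ 2 = \sum_n rnorm (f n) ^+ 2.
Proof. by rewrite L2normE sqr_sqrtr ?sumr_ge0// => n _; exact: sqr_ge0. Qed.

(** Cauchy-Schwarz against a column of [U], which has length one. *)
Lemma rnorm_gft_mx_coord N (U : 'M[K]_N) (f : L2 X N) i : unitary U ->
  rnorm (gft_mx U f i) <= rnorm f.
Proof.
move=> unU.
rewrite -(@ler_pXn2r _ 2) ?nnegrE ?rnorm_ge0// rnorm_L2_sqr.
rewrite -[leRHS]mul1r -(unitary_col_norm _ _ i unU).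
apply: le_trans (cauchy_schwarz_sum _ _).
rewrite ler_pXn2r ?nnegrE ?rnorm_ge0//; last first.
  by apply: sumr_ge0 => n _; rewrite mulr_ge0 ?rnorm_ge0 ?ReK_ge0.
rewrite gft_mxE; apply: le_trans (ler_rnorm_sum _ _ _ _ _) _.
by apply: ler_sum => n _; rewrite rnormZ norm_conjK.
Qed.

Lemma rnorm_gft_mx_le N (U : 'M[K]_N) (f : L2 X N) : unitary U ->
  rnorm (gft_mx U f) <= Num.sqrt N%:R * rnorm f.
Proof.
move=> unU; rewrite L2normE.
rewrite -[X in _ * X]ger0_norm ?rnorm_ge0// -sqrtr_sqr -sqrtrM ?ler0n//.
rewrite ler_wsqrtr// mulr_natl.
have -> : rnorm f ^+ 2 *+ N = \sum_(i < N) rnorm f ^+ 2.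
  by rewrite sumr_const card_ord.
apply: ler_sum => i _; rewrite ler_pXn2r ?nnegrE ?rnorm_ge0//.
exact: rnorm_gft_mx_coord.
Qed.

(** Concentrating a unit vector at one vertex: its transform spreads it along a
    row of [U], which has length one. *)
Lemma gft_mx_unit_vector N (U : 'M[K]_N) : (exists x : X, x != 0) ->
  (1 <= N)%N -> unitary U ->
  exists f : L2 X N, rnorm f = 1 /\ rnorm (gft_mx U f) = 1.
Proof.
move=> /exists_rnorm1[x x1] N0 unU; pose i0 : 'I_N := Ordinal N0.
pose f : L2 X N := [ffun n => if n == i0 then x else 0]; exists f.
split; rewrite L2normE.
  rewrite (bigD1 i0)//= big1 ?addr0 => [|n ni].
    by rewrite ffunE eqxx x1 expr1n sqrtr1.
  by rewrite ffunE (negPf ni) rnorm0 expr0n.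
rewrite -sqrtr1 -(unitary_col_norm _ _ i0 (unitary_adjoint _ _ unU)).
congr Num.sqrt; apply: eq_bigr => i _.
rewrite gft_mxE (bigD1 i0)//= big1 ?addr0 => [|n ni].
  by rewrite ffunE eqxx rnormZ x1 mulr1 adjointE.
by rewrite ffunE (negPf ni) scaler0.
Qed.

Lemma exists_L2_neq0 N : (exists x : X, x != 0) -> (1 <= N)%N ->
  exists f : L2 X N, f != 0.
Proof.
move=> [x x0] N0; exists [ffun=> x].
apply: contra x0 => /eqP/ffunP/(_ (Ordinal N0)).
by rewrite !ffunE => /eqP.
Qed.

Lemma gft_mx_topological_isomorphism N (U : 'M[K]_N) : unitary U ->
  topological_isomorphism (gft_mx U : L2 X N -> L2 X N).
Proof.
move=> unU.
have cont (V : 'M[K]_N) :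
    unitary V -> continuous (gft_mx V : L2 X N -> L2 X N).
  move=> unV; apply: bounded_linear_map_continuous (gft_mx_linear _ _) _.
  by move=> f; exact: rnorm_gft_mx_le.
split; [exact: gft_mx_linear | exact: cont |].
exists (gft_mx (adjoint U)); split.
- exact: gft_mxK.
- exact: gft_mxVK.
- exact/cont/unitary_adjoint.
Qed.

Lemma op_norm_gft_mx N (U : 'M[K]_N) : (exists x : X, x != 0) ->
  (1 <= N)%N -> unitary U ->
  (1 <= op_norm (gft_mx U : L2 X N -> L2 X N) <= (Num.sqrt N%:R)%:E)%E.
Proof.
move=> X0 N0 unU; apply/andP; split.
  have [f [f1 Ff1]] := gft_mx_unit_vector _ _ X0 N0 unU.
  by rewrite -[X in (X%:E <= _)%E]Ff1 le_op_norm ?f1.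
by apply: op_norm_le => [|f]; [exact: sqrtr_ge0 | exact: rnorm_gft_mx_le].
Qed.

(** A contraction whose inverse is a contraction is an isometry, and the inverse
    of the transform of [U] is the transform of the unitary matrix [U^*]. *)
Lemma contractive_gft_isometric N :
  (forall U : 'M[K]_N, unitary U ->
     op_norm (gft_mx U : L2 X N -> L2 X N) = 1%E) ->
  forall U : 'M[K]_N, unitary U ->
    forall f : L2 X N, rnorm (gft_mx U f) = rnorm f.
Proof.
move=> norm1 U unU f.
have le_norm V (g : L2 X N) : unitary V -> rnorm (gft_mx V g) <= rnorm g.
  move=> /norm1 V1.
  exact: (op_norm1_contraction _ _ _ _ _ (gft_mx_linear _ _) V1).
apply/eqP; rewrite eq_le le_norm//= -[X in rnorm X <= _](gft_mxK _ _ unU).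
exact/le_norm/unitary_adjoint.
Qed.

(** Expanding the inner products and summing over the frequencies first leaves
    the entries of [U U^*], that is, only the diagonal terms. *)
Lemma dot_gft_isometric N (ip : {dot X for @conjK R k}) (U : 'M[K]_N)
    (f : L2 X N) :
  (forall x : X, `|x| ^+ 2 = ip x x) -> unitary U ->
  rnorm (gft_mx U f) = rnorm f.
Proof.
move=> ipE [UU _]; apply/eqP; rewrite -(@eqrXn2 _ 2) ?rnorm_ge0//.
suff : ofR k (rnorm (gft_mx U f) ^+ 2) = ofR k (rnorm f ^+ 2).
  by move=> /(congr1 (@ReK R k)); rewrite !ofRK => ->.
rewrite !rnorm_L2_sqr !ofR_sum.
(* Each squared coordinate becomes a double sum over vertices n and m. *)
under eq_bigr => i _.
  rewrite expr2 ofRM ofR_rnorm -expr2 ipE gft_mxE linear_sumr.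
  under eq_bigr => n _ do
    (rewrite linear_sumlz;
     under eq_bigr => m _ do rewrite linearZr_LR linearZl_LR).
  over.
rewrite exchange_big; apply: eq_bigr => n _ /=.
rewrite exchange_big /= (bigD1 n)//= [X in _ + X]big1 ?addr0 => [|m mn].
  have /matrixP/(_ n n) := UU; rewrite !mxE eqxx => UUnn.
  under eq_bigr => i _ do rewrite /= conjKK mulrA -adjointE.
  by rewrite -mulr_suml UUnn mul1r expr2 ofRM ofR_rnorm -expr2 ipE.
have /matrixP/(_ n m) := UU; rewrite !mxE eq_sym (negPf mn) => UUnm.
under eq_bigr => i _ do rewrite /= conjKK mulrA -adjointE.
by rewrite -mulr_suml UUnm mul0r.
Qed.

End Fourier.

(** * Reflections of two coordinates *)

Section PlaneReflection.
Context (R : realType) (k : scalar_kind).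
Local Notation K := (scalar_field R k).

Definition reflection2 (a b : R) : 'M[K]_2 :=
  \matrix_(i < 2, j < 2) ofR k (nth [::] [:: [:: a; b]; [:: b; - a]] i)`_j.

Definition plane_reflection (a b : R) N : 'M[K]_(2 + N) :=
  block_mx (reflection2 a b) 0 0 1%:M.

Lemma unitary_plane_reflection (a b : R) N :
  a ^+ 2 + b ^+ 2 = 1 -> unitary (plane_reflection a b N).
Proof.
move=> ab1.
have adjE : adjoint (plane_reflection a b N) = plane_reflection a b N.
  rewrite /adjoint map_block_mx tr_block_mx !raddf0 map_mx1 trmx1.
  congr block_mx; apply/matrixP => i j; rewrite !mxE conjK_ofR; congr ofR.
  by case: i j => -[|[|]]// ? [[|[|]]].
suff sqr1 : plane_reflection a b N *m plane_reflection a b N = 1%:M.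
  by rewrite /unitary adjE.
rewrite mulmx_block !mulmx0 !mul0mx !addr0 !add0r mulmx1.
rewrite [RHS](@scalar_mx_block _ 2 N); congr block_mx.
apply/matrixP => i j.
rewrite !mxE 2!big_ord_recl big_ord0 !mxE addr0 -!ofRM -!ofRD.
have -> : (i == j)%:R = ofR k ((i == j)%:R : R).
  by case: (i == j); rewrite ?ofR1 ?ofR0.
congr ofR.
by case: i j => -[|[|]]// ? [[|[|]]]//= ?; nra.
Qed.

Context (X : normedModType K).

(** For [b = a] this is the parallelogram law; letting the angle vary is what
    yields real homogeneity of the inner product without a limit argument. *)
Lemma unitary_invariant_plane N :
  (forall U : 'M[K]_(2 + N), unitary U ->
     forall f : L2 X (2 + N), rnorm (gft_mx U f) = rnorm f) ->
  forall (a b : R) (x y : X),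
    rnorm (ofR k a *: x + ofR k b *: y) ^+ 2 +
      rnorm (ofR k b *: x - ofR k a *: y) ^+ 2 =
    (a ^+ 2 + b ^+ 2) * (rnorm x ^+ 2 + rnorm y ^+ 2).
Proof.
move=> invU.
have unit_case (a b : R) (x y : X) : a ^+ 2 + b ^+ 2 = 1 ->
    rnorm (ofR k a *: x + ofR k b *: y) ^+ 2 +
      rnorm (ofR k b *: x - ofR k a *: y) ^+ 2 = rnorm x ^+ 2 + rnorm y ^+ 2.
  move=> ab1.
  (* Past the first two vertices [f] takes the default value 0 of [nth]. *)
  pose f : L2 X (2 + N) := [ffun n : 'I_(2 + N) => [:: x; y]`_n].
  have := invU _ (unitary_plane_reflection a b N ab1) f.
  move=> /(congr1 (fun r => r ^+ 2)); rewrite !rnorm_L2_sqr !big_split_ord /=.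
  have gftE (i : 'I_(2 + N)) : gft_mx (plane_reflection a b N) f i =
      conjK (plane_reflection a b N (lshift N ord0) i) *: x +
      conjK (plane_reflection a b N (lshift N ord_max) i) *: y.
    rewrite gft_mxE big_split_ord /= [X in _ + X]big1 ?addr0; last first.
      by move=> n _; rewrite ffunE /= nth_default ?scaler0.
    rewrite 2!big_ord_recl big_ord0 addr0 !ffunE.
    by congr (conjK (plane_reflection a b N _ _) *: _ +
              conjK (plane_reflection a b N _ _) *: _); exact/val_inj.
  rewrite [X in _ + X]big1; last first.
    move=> n _; rewrite gftE /plane_reflection !block_mxEur !mxE.
    by rewrite rmorph0 !scale0r addr0 rnorm0 expr0n.
  rewrite [X in _ = _ + X]big1; last first.
    by move=> n _; rewrite ffunE /= nth_default// rnorm0 expr0n.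
  rewrite !addr0 !big_ord_recl !big_ord0 !addr0 !gftE.
  rewrite /plane_reflection !block_mxEul !mxE !ffunE /= !conjK_ofR.
  by rewrite -[- a]sub0r ofRB ofR0 sub0r scaleNr.
move=> a b x y; pose r := Num.sqrt (a ^+ 2 + b ^+ 2).
have r2 : r ^+ 2 = a ^+ 2 + b ^+ 2 by rewrite sqr_sqrtr ?addr_ge0 ?sqr_ge0.
have [r0|r0] := eqVneq r 0.
  have [a0 b0] : a = 0 /\ b = 0 by split; nra.
  by rewrite a0 b0 ofR0 !scale0r addr0 subr0 rnorm0 expr0n /= addr0 mul0r.
have := unit_case (a / r) (b / r) (ofR k r *: x) (ofR k r *: y).
rewrite !scalerA -!ofRM !divfK//; move=> ->.
  by rewrite !rnormZr !exprMn !real_normK ?num_real// r2 mulrDr.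
by rewrite !exprMn !exprVn r2 -mulrDl mulfV// -r2 sqrf_eq0.
Qed.

End PlaneReflection.

(** * The Jordan-von Neumann construction *)

Section RealPolarization.
Context (R : realType) (k : scalar_kind).
Local Notation K := (scalar_field R k).
Context (X : normedModType K).

(** Polarization: the real part of any inner product inducing the norm. *)
Definition real_dot (x y : X) : R :=
  (rnorm (x + y) ^+ 2 - rnorm (x - y) ^+ 2) / 4.

Lemma rnormN (x : X) : rnorm (- x) = rnorm x.
Proof. by rewrite /rnorm normrN. Qed.

Lemma real_dotC (x y : X) : real_dot x y = real_dot y x.
Proof. by rewrite /real_dot [x + y]addrC -[rnorm (x - y)]rnormN opprB. Qed.

Lemma real_dotNl (x y : X) : real_dot (- x) y = - real_dot x y.
Proof.
have negD u : rnorm (- x + u) = rnorm (x - u).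
  by rewrite -rnormN opprD opprK.
by rewrite /real_dot !negD opprK; lra.
Qed.

Lemma real_dotZxx (a : R) (x : X) :
  real_dot (ofR k a *: x) x = a * rnorm x ^+ 2.
Proof.
have addx : ofR k a *: x + x = ofR k (a + 1) *: x.
  by rewrite ofRD ofR1 scalerDl scale1r.
have subx : ofR k a *: x - x = ofR k (a - 1) *: x.
  by rewrite ofRB ofR1 scalerBl scale1r.
rewrite /real_dot addx subx.
rewrite !rnormZr !exprMn !real_normK ?num_real//; lra.
Qed.

Lemma real_dotxx (x : X) : real_dot x x = rnorm x ^+ 2.
Proof. by have := real_dotZxx 1 x; rewrite ofR1 scale1r mul1r. Qed.

Hypothesis planeE : forall (a b : R) (x y : X),
  rnorm (ofR k a *: x + ofR k b *: y) ^+ 2 +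
    rnorm (ofR k b *: x - ofR k a *: y) ^+ 2 =
  (a ^+ 2 + b ^+ 2) * (rnorm x ^+ 2 + rnorm y ^+ 2).

Lemma parallelogram (x y : X) :
  rnorm (x + y) ^+ 2 + rnorm (x - y) ^+ 2 =
  2 * (rnorm x ^+ 2 + rnorm y ^+ 2).
Proof. by have := planeE 1 1 x y; rewrite ofR1 !scale1r expr1n. Qed.

Lemma rnormD_sqr (x y : X) :
  rnorm (x + y) ^+ 2 = rnorm x ^+ 2 + rnorm y ^+ 2 + 2 * real_dot x y.
Proof. by have := parallelogram x y; rewrite /real_dot; lra. Qed.

(** By the parallelogram law around x + z and around x - z, the value at x is
    the mean of the values at x + y and x - y. Exchanging x and y and adding the two
    identities cancels the values at x - y and y - x. *)
Lemma real_dotDl (x y z : X) :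
  real_dot (x + y) z = real_dot x z + real_dot y z.
Proof.
have mid u v : real_dot (u + v) z + real_dot (u - v) z = 2 * real_dot u z.
  have := parallelogram (u + z) v; have := parallelogram (u - z) v.
  rewrite /real_dot ![u + z + _]addrAC ![u - z + _]addrAC; lra.
have := mid x y; have := mid y x.
by rewrite -[y - x]opprB real_dotNl [y + x]addrC; lra.
Qed.

Lemma real_dotDr (x y z : X) :
  real_dot x (y + z) = real_dot x y + real_dot x z.
Proof. by rewrite real_dotC real_dotDl real_dotC [real_dot z x]real_dotC. Qed.

(** Compare the two sides of the plane identity with [b = 1] after expanding
    both squares: only the mixed terms remain. *)
Lemma real_dot_selfadjoint (a : R) (x y : X) :
  real_dot (ofR k a *: x) y = real_dot x (ofR k a *: y).
Proof.
have := planeE a 1 x y; rewrite ofR1 !scale1r expr1n !rnormD_sqr rnormN.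
rewrite [real_dot x (- _)]real_dotC real_dotNl [real_dot _ x]real_dotC.
rewrite !rnormZr !exprMn !real_normK ?num_real//; lra.
Qed.

(** Both sides agree on the diagonal, and multiplication by [a] is
    self-adjoint, so they agree by polarization. *)
Lemma real_dotZl (a : R) (x y : X) :
  real_dot (ofR k a *: x) y = a * real_dot x y.
Proof.
have := real_dotZxx a (x + y).
rewrite rnormD_sqr scalerDr real_dotDl !real_dotDr !real_dotZxx.
by rewrite [real_dot (_ *: y) x]real_dotC -real_dot_selfadjoint; lra.
Qed.

Lemma real_dot_isometry (c : K) (x y : X) : `|c| = 1 ->
  real_dot (c *: x) (c *: y) = real_dot x y.
Proof.
move=> c1; have ReK1 : ReK `|c| = 1 by rewrite c1 -ofR1 ofRK.
by rewrite /real_dot -scalerBr -scalerDr !rnormZ ReK1 !mul1r.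
Qed.

End RealPolarization.

(** * Real and complex inner products *)

(** A sesquilinear form only has to be linear on the left: the right-hand side
    follows by conjugate symmetry. *)
Lemma is_hilbert_of_form (R : realType) (k : scalar_kind)
    (X : completeNormedModType (scalar_field R k))
    (ip : X -> X -> scalar_field R k) :
  (forall z, linear_for *%R (ip ^~ z)) ->
  (forall x y, ip x y = conjK (ip y x)) ->
  (forall x, `|x| ^+ 2 = ip x x) -> is_hilbert X.
Proof.
move=> linl herm ipE.
have linr z : linear_for (@conjK R k \; *%R) (ip z).
  move=> a x y; rewrite /= herm linl rmorphD rmorphM.
  by rewrite (herm z x) (herm z y).
pose bil := isBilinear.Build _ X X _ *%R (@conjK R k \; *%R) ip
  (fun z => zmod_morphism_linear (linl z))
  (fun z => zmod_morphism_linear (linr z))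
  (fun z => scalable_linear (linl z))
  (fun z => scalable_linear (linr z)).
have herm0 x y : ip x y = (-1) ^+ false * conjK (ip y x).
  by rewrite expr0 mul1r.
pose her := isHermitianSesquilinear.Build _ X false (@conjK R k) ip herm0.
have pos x : x != 0 -> 0 < ip x x.
  by move=> x0; rewrite -ipE exprn_gt0// normr_gt0.
pose dot := isDotProduct.Build _ X ip pos.
pose form : {dot X for @conjK R k} := HB.pack ip bil her dot.
by exists form.
Qed.

(** Over the complex numbers, [J] below is multiplication by i. It preserves
    [real_dot] because it preserves the norm, and J^2 = -1, so it is
    skew-adjoint: this makes the form [B x y + i B x (J y)] conjugate symmetric,
    complex linear on the left, and real on the diagonal. *)
Lemma plane_identity_hilbert (R : realType) (k : scalar_kind)
    (X : completeNormedModType (scalar_field R k)) :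
  (forall (a b : R) (x y : X),
    rnorm (ofR k a *: x + ofR k b *: y) ^+ 2 +
      rnorm (ofR k b *: x - ofR k a *: y) ^+ 2 =
    (a ^+ 2 + b ^+ 2) * (rnorm x ^+ 2 + rnorm y ^+ 2)) ->
  is_hilbert X.
Proof.
case: k X => X planeE.
  apply: (@is_hilbert_of_form R RealScalars X (real_dot R RealScalars X)).
  - move=> z a x y; rewrite (real_dotDl _ _ _ planeE).
    by rewrite (real_dotZl _ _ _ planeE a).
  - by move=> x y; rewrite /= real_dotC.
  - by move=> x; rewrite real_dotxx.
pose B : X -> X -> R := real_dot R ComplexScalars X.
pose J (x : X) : X := ('i : R[i]) *: x.
have normi : `|'i%C : R[i]| = 1.
  by rewrite normc_def /= expr0n expr1n add0r sqrtr1.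
have JJ x : J (J x) = - x.
  by rewrite /J scalerA -expr2 sqr_i scaleN1r.
have BJJ x y : B (J x) (J y) = B x y by apply: real_dot_isometry.
have BC x y : B x y = B y x by apply: real_dotC.
have BNl x y : B (- x) y = - B x y by apply: real_dotNl.
have BJl x y : B (J x) y = - B x (J y) by rewrite -BJJ JJ BNl.
have BDl x y z : B (x + y) z = B x z + B y z by apply: real_dotDl.
have BZl (p q : R) x y : B ((p +i* q)%C *: x) y = p * B x y - q * B x (J y).
  have -> : (p +i* q)%C *: x = (p%:C)%C *: x + (q%:C)%C *: J x.
    by rewrite scalerA -scalerDl; congr (_ *: _); simpc.
  rewrite BDl /B !(real_dotZl R ComplexScalars X planeE).
  by rewrite -/B BJl mulrN.
apply: (@is_hilbert_of_form R ComplexScalars X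
  (fun x y => (B x y +i* B x (J y))%C)).
- move=> z [p q] x y; rewrite !BDl !BZl JJ.
  rewrite [B x (- z)]BC BNl [B z x]BC; simpc.
  by congr (_ +i* _)%C; ring.
- by move=> x y /=; rewrite [B y (J x)]BC BJl opprK BC.
- move=> x; rewrite -ofR_rnorm /=.
  have -> : B x (J x) = 0 by have := BJl x x; rewrite BC; lra.
  by rewrite /B real_dotxx -rmorphXn.
Qed.

Lemma unitary_invariant_hilbert (R : realType) (k : scalar_kind)
    (X : completeNormedModType (scalar_field R k)) (N : nat) : (2 <= N)%N ->
  (forall U : 'M[scalar_field R k]_N, unitary U ->
     forall f : L2 X N, rnorm (gft_mx U f) = rnorm f) -> is_hilbert X.
Proof.
move: N => [|[|N]]// _ invU; apply: plane_identity_hilbert.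
exact: (unitary_invariant_plane R k X N).
Qed.

Theorem theorem2p5 (R : realType) (k : scalar_kind)
  (X : completeNormedModType (scalar_field R k)) (N : nat)
  (X_neq0 : exists x : X, x != 0) (N_gt0 : (1 <= N)%N) :
  [/\ (* (a) *)
      forall u : 'I_N -> 'cV[scalar_field R k]_N, orthonormal_basis u ->
        topological_isomorphism (gft u : L2 X N -> L2 X N) /\
        (1 <= op_norm (gft u : L2 X N -> L2 X N) <= (Num.sqrt N%:R)%:E)%E,
      (* (b) *)
      N = 1%N -> forall u : scalar_field R k, `|u| = 1 ->
        let F : L2 X N -> L2 X N := gft (fun _ => const_mx u) in
        [/\ forall f : L2 X N, rnorm (F f) = rnorm f,
            isometric_isomorphism F
          & op_norm F = 1%E],
      (* (c) *)
      (2 <= N)%N ->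
        ((forall U : 'M[scalar_field R k]_N, unitary U ->
            forall f : L2 X N, rnorm (gft_mx U f) = rnorm f)
         <-> is_hilbert X)
    & (* (d) *)
      (2 <= N)%N ->
        ((forall U : 'M[scalar_field R k]_N, unitary U ->
            op_norm (gft_mx U : L2 X N -> L2 X N) = 1%E)
         <-> is_hilbert X) ].
Proof.
have hilbert_isometric : is_hilbert X ->
    forall U : 'M[scalar_field R k]_N, unitary U ->
      forall f : L2 X N, rnorm (gft_mx U f) = rnorm f.
  by move=> [ip ipE] U unU f; apply: dot_gft_isometric ipE unU.
have isometric_norm1 (T : L2 X N -> L2 X N) :
    (forall f, rnorm (T f) = rnorm f) -> op_norm T = 1%E.
  exact/op_norm_isometry/exists_L2_neq0.
split.
- move=> u [_ /orthonormal_unitary unU]; rewrite gft_gft_mx.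
  split; first exact: gft_mx_topological_isomorphism.
  exact: op_norm_gft_mx.
- move=> N1 u u1 F; rewrite {}/F gft_gft_mx; set U := \matrix_(n, i) _.
  have unU : unitary U.
    apply: orthonormal_unitary => i j; rewrite /dotK; subst N.
    by rewrite !ord1 big_ord1 !mxE mulKconj u1 expr1n.
  have isoU (f : L2 X N) : rnorm (gft_mx U f) = rnorm f.
    rewrite !L2normE; congr Num.sqrt; clear unU; subst N.
    rewrite !big_ord1 gft_mxE big_ord1 rnormZ norm_conjK !mxE u1.
    by rewrite -ofR1 ofRK mul1r.
  split=> //; last exact: isometric_norm1.
  split; first exact: gft_mx_linear.
    by exists (gft_mx (adjoint U)); [exact: gft_mxK | exact: gft_mxVK].
  by move=> f; rewrite -!ofR_rnorm isoU.
- move=> N2; split; last exact: hilbert_isometric.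
  exact: unitary_invariant_hilbert.
- move=> N2; split=> [norm1|hX U unU].
    apply: (unitary_invariant_hilbert _ _ _ _ N2).
    exact: contractive_gft_isometric norm1.
  exact/isometric_norm1/hilbert_isometric.
Qed.
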